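(* Let $k$ be a field, $G$ a group, and $A$ a $G$-algebra over $k$ which is completely reducible as a representation of $G$. Then $S_G(A)$ is weakly reproducible of finite length if either (1) $A$ is a finite Galois extension of $k$ and $G$ is the Galois group; or (2) $A=\mathrm{End}(V)$ is a finite-dimensional $G$-algebra whose underlying projective representation $V$ is irreducible.
   Context: A $G$-algebra is an associative $k$-algebra $A$ with identity on which $G$ acts by $k$-algebra automorphisms. $S_G(A)$ is the set of all $k[G]$-submodules of $A$, viewed as a lattice under sum and intersection, with product $EF=\mathrm{span}\{ef\mid e\in E,f\in F\}$. Completely reducible means a direct sum of irreducible representations. The atoms (minimal nonzero elements) of $S_G(A)$ are the irreducible submodules of $A$; $\mathcal{Q}_G(A)$ denotes the set of them, and $k=k1_A$ is one of them. $S_G(A)$ is weakly reproducible if it is entire (i.e. $EF=0$ with $E,F\in S_G(A)$ implies $E=0$ or $F=0$) and for every $X\in\mathcal{Q}_G(A)$ there exist $Y,Z\in\mathcal{Q}_G(A)$ with $k\subset XY$ and $k\subset ZX$. It has finite length if there is a finite bound on the lengths of chains in the lattice $S_G(A)$. If $V$ is a finite-dimensional nonzero vector space and $\mathrm{End}(V)$ is a $G$-algebra, then each $g\in G$ acts by conjugation by some element of $\mathrm{GL}(V)$ unique up to scalars, giving a homomorphism $G\to\mathrm{PGL}(V)$; this is the underlying projective representation $V$, and it is irreducible if $V$ has no $G$-invariant subspaces other than $0$ and $V$. *)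

(* Defs.v *)
From mathcomp Require Import all_boot all_order all_algebra all_fingroup.
From mathcomp Require Import all_field.
From mathcomp Require Import all_classical.

Set Implicit Arguments.
Unset Strict Implicit.
Unset Printing Implicit Defensive.

Import GRing.Theory.
Local Open Scope classical_set_scope.
Local Open Scope ring_scope.

(* [G] may be infinite and [A] infinite-dimensional.  Each [Gact g] is only
   required to be an algebra endomorphism: it is invertible, with inverse
   [Gact g^-1], by the two action laws. *)
Record Galgebra (k : fieldType) (G : groupType) := {
  Galg_sort :> algType k;
  Gact : G -> {lrmorphism Galg_sort -> Galg_sort};
  Gact1 : forall a, Gact 1%g a = a;
  GactM : forall g h a, Gact (g * h)%g a = Gact g (Gact h a)
}.

Arguments Gact {k G A} g : rename.

Section SubmoduleLattice.
Variables (k : fieldType) (G : groupType) (A : Galgebra k G).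

(* S_G(A), ordered by inclusion: this is the order of the lattice whose join
   and meet are the sum and the intersection of submodules. *)
Definition SG : set (set A) :=
  [set E | [/\ E 0,
               forall (c : k) (x y : A), E x -> E y -> E (c *: x + y)
             & forall (g : G) (x : A), E x -> E (Gact g x)]].

(* Q_G(A): the minimal nonzero elements of S_G(A) *)
Definition QG : set (set A) :=
  [set X | [/\ SG X, X <> [set 0]
             & forall E, SG E -> E `<=` X -> E = [set 0] \/ E = X]].

Definition lspan (S : set A) : set A :=
  [set x | exists (n : nat) (c : 'I_n -> k) (s : 'I_n -> A),
             (forall i, S (s i)) /\ x = \sum_(i < n) c i *: s i].

Definition mulS (E F : set A) : set A :=
  lspan [set e * f | e in E & f in F].

(* k = k 1_A *)
Definition scalars : set A := [set c%:A | c in [set: k]].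

(* [A] is the internal direct sum of the irreducible submodules [X i].  The
   index type is arbitrary, so [A] may have infinitely many summands. *)
Definition completely_reducible : Prop :=
  exists (I : eqType) (X : I -> set A),
    [/\ forall i, QG (X i),
        forall a : A, exists (s : seq I) (x : I -> A),
          (forall i, X i (x i)) /\ a = \sum_(i <- s) x i
      & forall (s : seq I) (x : I -> A),
          uniq s -> (forall i, X i (x i)) -> \sum_(i <- s) x i = 0 ->
          forall i, i \in s -> x i = 0].

Definition entire : Prop :=
  forall E F, SG E -> SG F -> mulS E F = [set 0] -> E = [set 0] \/ F = [set 0].

Definition weakly_reproducible : Prop :=
  entire /\
  forall X, QG X ->
    exists Y Z, [/\ QG Y, QG Z, scalars `<=` mulS X Y & scalars `<=` mulS Z X].

(* Chains C 0 < C 1 < ... < C m of S_G(A) have bounded length [m]; the values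
   of [C] beyond [m] are irrelevant. *)
Definition finite_length : Prop :=
  exists n : nat, forall (m : nat) (C : nat -> set A),
    (forall i, (i <= m)%N -> SG (C i)) ->
    (forall i, (i < m)%N -> C i `<` C i.+1) ->
    (m <= n)%N.

(* [A] is identified with [L] by the algebra isomorphism [phi], and [G] with
   Gal(L / k) by the bijection [psi], compatibly with the actions.  The library
   composes Galois automorphisms in the order opposite to a left action
   ([galM]), so [psi] reverses products.  A [splittingFieldType k] is a
   finite-dimensional normal field extension of [k]. *)
Definition is_finite_Galois_extension : Prop :=
  exists (L : splittingFieldType k) (phi : {lrmorphism A -> L})
         (psi : G -> gal_of {:L}),
    [/\ galois 1%AS {:L},
        bijective phi,
        injective psi,
        forall s, s \in 'Gal({:L} / 1%AS)%g <-> exists g, psi g = s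
      & forall g a, phi (Gact g a) = psi g (phi a)].

Section EndomorphismAlgebra.
Variables (V : vectType k) (phi : A -> 'End(V)).

(* The class of [g] in PGL(V): all [h] in GL(V) by whose conjugation [g] acts on
   End(V).  It is nonempty by the Skolem-Noether theorem and it is a single
   orbit of the scalars.  Since V is finite-dimensional, [lker h == 0] means
   that [h] is invertible, and [h^-1] is then its two-sided inverse. *)
Definition PGL_class (g : G) : set 'End(V) :=
  [set h : 'End(V) | lker h == 0%VS /\
     forall a, phi (Gact g a) = (h \o phi a \o h^-1)%VF].

Definition proj_invariant (U : {vspace V}) : Prop :=
  forall g h, PGL_class g h -> (h @: U <= U)%VS.

Definition proj_irreducible : Prop :=
  forall U : {vspace V}, proj_invariant U -> U = 0%VS \/ U = fullv.

End EndomorphismAlgebra.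

(* The ring structure of 'End(V) is not canonical in the library (it needs V to
   be nonzero), hence the explicit multiplicativity of [phi]. *)
Definition is_End_of_irreducible_projective_rep : Prop :=
  exists (V : vectType k) (phi : {linear A -> 'End(V)}),
    [/\ (0 < \dim {:V})%N,
        bijective phi,
        phi 1 = \1%VF,
        forall a b, phi (a * b) = (phi a \o phi b)%VF
      & proj_irreducible phi].

End SubmoduleLattice.

(* Main.v *)
From HB Require Import structures.
Require Import Defs.
From mathcomp Require Import all_boot all_order all_algebra all_fingroup.
From mathcomp Require Import all_field.
From mathcomp Require Import all_classical.

(** In both cases [A] is finite-dimensional, which bounds the length of chains,
    and every nonzero submodule [E] satisfies [E A = A E = A]
    ([unital_ideals]).  In a field this is clear.  In [End(V)] it is a density
    argument: [E V] and the common kernel of [E] are invariant subspaces of the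
    irreducible [V], hence equal to [V] and [0] ([End_unital_ideals]).

    The rest uses only these two facts and complete reducibility.  If [E F = 0]
    with [E] nonzero, then [F] lies in [A E F = 0].  Now let [X] be irreducible.
    Since [X A = A] and [A] is the sum of its irreducible submodules, the
    products [X Y], for [Y] irreducible, cannot all lie in an invariant
    complement of [k]; so some [X Y] maps onto the trivial representation
    [k], and by complete reducibility it contains a nonzero invariant [d]
    ([ex_augmentation]).  Applying [unital_ideals] to the line [k d] shows that
    [d] is invertible ([fixed_inverse]), its inverse is invariant, and
    [Y d^-1] is an irreducible submodule with [1] in [X (Y d^-1)]
    ([ex_right_cofactor]).  The other side is symmetric. *)

Set Implicit Arguments.
Unset Strict Implicit.
Unset Printing Implicit Defensive.

Import GRing.Theory.
Local Open Scope classical_set_scope.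
Local Open Scope ring_scope.

(** * Finite-dimensional linear algebra *)

(** Subsets closed under linear combinations are turned into objects with a
    dimension and a basis: a subspace of largest dimension among those contained
    in [S] must be all of [S]. *)
Lemma vspace_of_set (k : fieldType) (W : vectType k) (S : set W) :
  S 0 -> (forall c x y, S x -> S y -> S (c *: x + y)) ->
  exists U : {vspace W}, forall x, x \in U <-> S x.
Proof.
move=> S0 SL.
pose P n := `[< exists U : {vspace W}, \dim U = n /\
                forall x, x \in U -> S x >].
have exP : exists n, P n.
  exists 0%N; apply/asboolP; exists 0%VS; split=> [|x].
    by rewrite dimv0.
  by rewrite memv0 => /eqP->.
have boundP n : P n -> (n <= \dim {:W})%N.
  by move=> /asboolP[U [<- _]]; apply: dimvS; exact: subvf.
case: (ex_maxnP exP boundP) => n /asboolP[U [dimU US]] maxU.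
exists U => x; split=> [|Sx]; first exact: US.
apply: contraT => nUx.
have /maxU : P (\dim (<[x]> + U)).
  apply/asboolP; exists (<[x]> + U)%VS; split=> // z.
  by move=> /memv_addP[y /vlineP[c ->] [u Uu ->]]; apply: SL => //; exact: US.
rewrite -dimU (geq_leqif (dimv_leqif_sup (addvSr _ _))) => /subvP sub.
move: nUx; rewrite sub //.
by apply: (subvP (addvSl _ _)); exact: memv_line.
Qed.

Section Generators.
Variables (k : fieldType) (V : vectType k) (n : nat).
Implicit Types (i : 'I_n) (e : 'I_n -> 'End(V)).

Definition single i (v : V) : {ffun 'I_n -> V} := [ffun j => v *+ (j == i)].

Fact single_linear i : linear (single i).
Proof.
move=> c u v; apply/ffunP => j; rewrite !ffunE.
by case: (j == i); rewrite ?mulr1n // !mulr0n scaler0 addr0.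
Qed.

HB.instance Definition _ i :=
  GRing.isLinear.Build _ _ _ _ (single i) (single_linear i).

(** Each vector is split along the images of the [e i], and each piece is pulled
    back by a linear section of [e i]. *)
Lemma right_inverse_sum e :
  (\sum_i limg (e i))%VS = fullv -> exists f, \sum_i (e i \o f i)%VF = \1%VF.
Proof.
move=> /esym im; exists (fun i => ((e i)^-1 \o sumv_pi_for im i)%VF).
apply/lfunP => v; rewrite sum_lfunE lfunE /=.
rewrite -[RHS](sumv_pi_sum im (memvf v)); apply: eq_bigr => i _.
by rewrite !comp_lfunE limg_lfunVK ?memv_sum_pi.
Qed.

Lemma memv_bigcap_lker e v :
  reflect (forall i, e i v = 0) (v \in (\bigcap_i lker (e i))%VS).
Proof.
rewrite memvE; apply: (iffP subv_bigcapP) => ev i => [|_].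
  by apply/eqP; rewrite -memv_ker memvE ev.
by rewrite -memvE memv_ker ev.
Qed.

(** The [e i] are the coordinates of one injective map from [V] to [V^n], and a
    left inverse of this map restricts to the required maps on the summands. *)
Lemma left_inverse_sum e :
  (\bigcap_i lker (e i))%VS = 0%VS -> exists f, \sum_i (f i \o e i)%VF = \1%VF.
Proof.
move=> ker0; pose T := \sum_i (linfun (single i) \o e i)%VF.
have TE v i : T v i = e i v.
  rewrite sum_lfunE sum_ffunE (bigD1 i) //= big1 => [|j ji].
    by rewrite comp_lfunE lfunE /= ffunE eqxx addr0.
  by rewrite comp_lfunE lfunE /= ffunE eq_sym (negPf ji).
have T0 : lker T == 0%VS.
  rewrite -subv0 -ker0; apply/subvP => v; rewrite memv_ker => /eqP Tv.
  by apply/memv_bigcap_lker => i; rewrite -TE Tv ffunE.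
exists (fun i => (T^-1 \o linfun (single i))%VF).
rewrite -(lker0_compVf T0); apply/lfunP => v.
rewrite !comp_lfunE !sum_lfunE linear_sum; apply: eq_bigr => i _.
by rewrite !comp_lfunE.
Qed.

End Generators.

(** * Submodules of a G-algebra *)

Section Submodules.
Variables (k : fieldType) (G : groupType) (A : Galgebra k G).
Implicit Types (E F W X Y : set A) (x y d : A).

Lemma SG_add E x y : SG E -> E x -> E y -> E (x + y).
Proof. by case=> _ EL _ Ex Ey; rewrite -[x]scale1r; apply: EL. Qed.

Lemma SG_scale E c x : SG E -> E x -> E (c *: x).
Proof. by case=> E0 EL _ Ex; rewrite -[_ *: _]addr0; apply: EL. Qed.

Lemma SG_opp E x : SG E -> E x -> E (- x).
Proof. by move=> SE Ex; rewrite -scaleN1r; apply: SG_scale. Qed.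

Lemma SG_sub E x y : SG E -> E x -> E y -> E (x - y).
Proof. by move=> SE Ex Ey; apply: SG_add => //; apply: SG_opp. Qed.

Lemma SG_sum E (I : Type) (r : seq I) (f : I -> A) :
  SG E -> (forall i, E (f i)) -> E (\sum_(i <- r) f i).
Proof.
move=> SE Ef; elim/big_ind: _ => //; first by case: SE.
by move=> x y; apply: SG_add.
Qed.

Lemma SG_zero : SG [set 0 : A].
Proof.
split=> //= [c x y -> ->|g x ->]; last by rewrite linear0.
by rewrite scaler0 addr0.
Qed.

Lemma SG_setI E F : SG E -> SG F -> SG (E `&` F).
Proof.
move=> [E0 EL EG] [F0 FL FG]; split=> //.
- by move=> c x y [Ex Fx] [Ey Fy]; split; [apply: EL | apply: FL].
- by move=> g x [Ex Fx]; split; [apply: EG | apply: FG].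
Qed.

Definition sumS E F : set A := [set x + y | x in E & y in F].

Lemma SG_sumS E F : SG E -> SG F -> SG (sumS E F).
Proof.
move=> [E0 EL EG] [F0 FL FG]; split.
- by exists 0 => //; exists 0 => //; rewrite addr0.
- move=> c _ _ [x Ex [y Fy <-]] [x' Ex' [y' Fy' <-]].
  exists (c *: x + x'); first exact: EL.
  exists (c *: y + y'); first exact: FL.
  by rewrite scalerDr addrACA.
- move=> g _ [x Ex [y Fy <-]]; exists (Gact g x); first exact: EG.
  by exists (Gact g y); [exact: FG | rewrite linearD].
Qed.

Lemma SG_neq0 E : SG E -> E <> [set 0] -> exists2 x, E x & x != 0.
Proof.
move=> [E0 _ _] Enz; apply: contrapT => nex; apply: Enz.
apply/seteqP; split=> [x Ex|_ ->] //=.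
by apply: contrapT => /eqP xnz; apply: nex; exists x.
Qed.

Lemma SG_line d : (forall g, Gact g d = d) -> SG [set c *: d | c in [set: k]].
Proof.
move=> dfix; split.
- by exists 0 => //; rewrite scale0r.
- move=> c _ _ [a _ <-] [b _ <-]; exists (c * a + b) => //.
  by rewrite scalerDl scalerA.
- by move=> g _ [a _ <-]; exists a => //; rewrite linearZ /= dfix.
Qed.

Lemma lspan_sub E (S : set A) : SG E -> S `<=` E -> lspan S `<=` E.
Proof.
move=> SE SubE _ [n [c [s [Ss ->]]]].
by apply: SG_sum => // i; apply: SG_scale => //; apply: SubE.
Qed.

Lemma sub_lspan (S : set A) : S `<=` lspan S.
Proof.
move=> x Sx; exists 1%N, (fun=> 1), (fun=> x); split=> //.
by rewrite big_ord1 scale1r.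
Qed.

Lemma SG_lspan (S : set A) :
  (forall g x, S x -> S (Gact g x)) -> SG (lspan S).
Proof.
move=> SGact; split.
- exists 0%N, (fun=> 0), (fun=> 0); split; last by rewrite big_ord0.
  by case.
- move=> c _ _ [n [a [s [Ss ->]]]] [m [b [t [St ->]]]].
  exists (n + m)%N.
  exists (fun i => match fintype.split i with
                   inl j => c * a j | inr j => b j end).
  exists (fun i => match fintype.split i with
                   inl j => s j | inr j => t j end).
  split=> [i|]; first by case: (fintype.split i).
  rewrite big_split_ord /= scaler_sumr; congr (_ + _); apply: eq_bigr => i _.
  + by rewrite (unsplitK (inl i)) scalerA.
  + by rewrite (unsplitK (inr i)).
- move=> g _ [n [c [s [Ss ->]]]]; exists n, c, (fun i => Gact g (s i)).
  split=> [i|]; first exact: SGact.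
  by rewrite linear_sum; apply: eq_bigr => i _; rewrite linearZ.
Qed.

Lemma mulS_mem E F x y : E x -> F y -> mulS E F (x * y).
Proof. by move=> Ex Fy; apply: sub_lspan; exists x => //; exists y. Qed.

Lemma SG_mulS E F : SG E -> SG F -> SG (mulS E F).
Proof.
move=> [_ _ EG] [_ _ FG]; apply: SG_lspan => g _ [x Ex [y Fy <-]].
exists (Gact g x); first exact: EG.
by exists (Gact g y); [exact: FG | rewrite rmorphM].
Qed.

Lemma mulS_subP E F W : SG W ->
  (forall x y, E x -> F y -> W (x * y)) -> mulS E F `<=` W.
Proof.
by move=> SW sub; apply: lspan_sub => // _ [x Ex [y Fy <-]]; apply: sub.
Qed.

Lemma scalars_sub E : SG E -> E 1 -> @scalars k G A `<=` E.
Proof. by move=> SE E1 _ [c _ <-]; apply: SG_scale. Qed.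

(** An automorphism of the representation [A] permutes its irreducible
    submodules. *)
Lemma QG_image (f h : A -> A) X : linear f -> linear h ->
  (forall g x, f (Gact g x) = Gact g (f x)) ->
  (forall g x, h (Gact g x) = Gact g (h x)) ->
  cancel f h -> cancel h f -> QG X -> QG (f @` X).
Proof.
have lin0 (u : A -> A) : linear u -> u 0 = 0.
  by move=> ul; have := ul (-1) 0 0; rewrite scaler0 addr0 scaleN1r addNr.
have im (u : A -> A) E : linear u ->
    (forall g x, u (Gact g x) = Gact g (u x)) ->
    SG E -> SG (u @` E).
  move=> ul uG [E0 EL EG]; split.
  - by exists 0; [| exact: lin0].
  - move=> c _ _ [x Ex <-] [y Ey <-].
    by exists (c *: x + y); [exact: EL | rewrite ul].
  - by move=> g _ [x Ex <-]; exists (Gact g x); [exact: EG | rewrite uG].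
move=> fl hl fG hG fK hK [SX Xnz Xmin].
have imK (u v : A -> A) E : cancel u v -> v @` (u @` E) = E.
  move=> uK; rewrite image_comp -[RHS]image_id.
  by apply: eq_imagel => x _; exact: uK.
split; first exact: im.
- move=> fX0; apply: Xnz.
  by rewrite -[X](imK _ _ _ fK) fX0 image_set1 lin0.
- move=> E SE EfX; have : h @` E `<=` X.
    by rewrite -[X](imK _ _ _ fK); apply: image_subset.
  move=> /(Xmin _ (im _ _ hl hG SE))[] hE; rewrite -[E](imK _ _ _ hK) hE.
  + by left; rewrite image_set1 lin0.
  + by right.
Qed.

(** * Complements and invariants *)

Lemma ex_maximal_SG (P : set A -> Prop) F : finite_length A ->
  (forall E, P E -> SG E) -> P F ->
  exists2 C, P C & forall C', P C' -> ~ C `<` C'.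
Proof.
move=> [n len] PS PF; apply: contrapT => nomax.
have next E : exists E', P E -> P E' /\ E `<` E'.
  apply: contrapT => no; apply: nomax; exists E.
    by apply: contrapT => nPE; apply: no; exists E => /nPE.
  by move=> E' PE' EE'; apply: no; exists E'.
have /choice[f fP] := next.
have Piter i : P (iter i f F) by elim: i => //= i /fP[].
have := len n.+1 (fun i => iter i f F) (fun i _ => PS _ (Piter i))
  (fun i _ => (fP _ (Piter i)).2).
by rewrite ltnn.
Qed.

Lemma completely_reducible_sum : completely_reducible A ->
  forall E, E 0 -> (forall x y, E x -> E y -> E (x + y)) ->
  (forall X, QG X -> X `<=` E) -> forall a, E a.
Proof.
move=> [I [X [XQ Xsum _]]] E E0 ED QE a.
have [s [x [Xx ->]]] := Xsum a.
by elim/big_ind: _ => // i _; apply: QE (XQ i) _ (Xx i).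
Qed.

(** A submodule [C] that is maximal among those meeting [E] trivially is a
    complement: an irreducible [X] not inside [E + C] would meet it trivially,
    and then [C + X] would still meet [E] trivially. *)
Lemma SG_complement : completely_reducible A -> finite_length A ->
  forall E, SG E -> exists C,
    [/\ SG C, forall x, E x -> C x -> x = 0 & forall a, sumS E C a].
Proof.
move=> cr fl E SE; have E0 : E 0 by case: SE.
pose P C := SG C /\ forall x, E x -> C x -> x = 0.
have [||C [SC EC] Cmax] := @ex_maximal_SG P [set 0] fl; first by move=> ? [].
  by split; [exact: SG_zero | move=> x _ ->].
exists C; split=> //; have C0 : C 0 by case: SC.
have SEC : SG (sumS E C) by exact: SG_sumS.
apply: completely_reducible_sum => // [|x y|X QX]; first by case: SEC.
  exact: SG_add.
have [SX _ Xmin] := QX; have X0 : X 0 by case: SX.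
have [XEC|XEC] : sumS E C `&` X = [set 0] \/ sumS E C `&` X = X.
- by apply: Xmin; [exact: SG_setI | move=> x []].
- move=> x Xx; have SCX : SG (sumS C X) by exact: SG_sumS.
  suff /Cmax : P (sumS C X).
    move=> noC; apply: contrapT => nECx; apply: noC; split.
      by move=> c Cc; exists c => //; exists 0 => //; rewrite addr0.
    move=> CXC; apply: nECx; exists 0 => //; exists x; last by rewrite add0r.
    by apply: CXC; exists 0 => //; exists x => //; rewrite add0r.
  split=> // e Ee [c Cc [y Xy cye]].
  have y0 : (sumS E C `&` X) y.
    split=> //; exists e => //; exists (- c); first exact: SG_opp.
    by rewrite -cye addrC addKr.
  move: y0 cye; rewrite XEC /= => ->; rewrite addr0 => ce.
  by apply: EC; rewrite // -ce.
- by rewrite -XEC => x [].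
Qed.

(** [B] is a complement of [k], so that [A / B] is the trivial representation.
    If [W] is not inside [B], a complement of [W `&` B] in [W] embeds into
    [A / B], and is therefore a line of invariants. *)
Lemma ex_augmentation : completely_reducible A -> finite_length A ->
  exists B, [/\ SG B, ~ B 1
    & forall W, SG W -> ~ W `<=` B ->
        exists d, [/\ W d, d != 0 & forall g, Gact g d = d]].
Proof.
move=> cr fl; have fix1 (g : G) : Gact g (1 : A) = 1 by exact: rmorph1.
have [B [SB capB sumB]] := SG_complement cr fl (SG_line fix1).
exists B; split=> // [B1|W SW WB].
  have /eqP := capB 1 (ex_intro2 _ _ 1 I (scale1r _)) B1.
  by rewrite oner_eq0.
have coinv g a : B (Gact g a - a).
  have [_ [c _ <-] [b Bb <-]] := sumB a.
  rewrite linearD linearZ /= fix1 opprD addrACA subrr add0r.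
  by apply: SG_sub => //; case: SB => _ _; apply.
have SN := SG_setI SW SB; have [C [SC capN sumN]] := SG_complement cr fl SN.
have [w Ww nBw] : exists2 w, W w & ~ B w.
  apply: contrapT => no; apply: WB => w Ww; apply: contrapT => nBw.
  by apply: no; exists w.
have [n [Wn Bn] [d Cd nd]] := sumN w.
have Wd : W d by rewrite -[d](addKr n) nd addrC; apply: SG_sub.
exists d; split=> // [|g].
- by apply: contra_notN nBw => /eqP d0; rewrite -nd d0 addr0.
- apply/eqP; rewrite -subr_eq0; apply/eqP; apply: capN.
  + by split; [apply: SG_sub => //; case: SW => _ _; apply | exact: coinv].
  + by apply: SG_sub => //; case: SC => _ _; apply.
Qed.

(** * Submodules generating the unit ideals *)

(** The one property that the two cases of the theorem have in common: a nonzero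
    submodule generates [A] as a right ideal and as a left ideal. *)
Definition unital_ideals : Prop := forall E, SG E -> E <> [set 0] ->
  mulS E setT 1 /\ mulS setT E 1.

(** [E F = 0] gives [F = 1 F], inside [(A E) F = A (E F) = 0]. *)
Lemma entire_of_unital_ideals : unital_ideals -> entire A.
Proof.
move=> ui E F SE SF EF0; have [|Enz] := pselect (E = [set 0]).
  by left.
right.
have [_ E1] := ui E SE Enz.
apply/seteqP; split=> [f Ff|_ ->] /=; last by case: SF.
have [n [c [s [Ss sum1]]]] := E1.
rewrite -[f]mul1r sum1 mulr_suml big1 // => i _.
have [a _ [e Ee <-]] := Ss i; rewrite -scalerAl -mulrA.
have : mulS E F (e * f) by exact: mulS_mem.
by rewrite EF0 /= => ->; rewrite mulr0 scaler0.
Qed.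

(** The line [k d] is a submodule, so [d A] and [A d] both contain [1]; the
    inverse of an invariant element is invariant because it is unique. *)
Lemma fixed_inverse : unital_ideals ->
  forall d, d != 0 -> (forall g, Gact g d = d) ->
  exists d', [/\ d * d' = 1, d' * d = 1 & forall g, Gact g d' = d'].
Proof.
move=> ui d dnz dfix.
have dline : [set c *: d | c in [set: k]] d by exists 1; rewrite ?scale1r.
have [|[n [c [s [Ss sum1]]]] [m [b [t [St sum2]]]]] := ui _ (SG_line dfix).
  by move=> line0; move: dline; rewrite line0 => /eqP; rewrite (negPf dnz).
have [u du] : exists u, 1 = d * u.
  have /choice[v vP] i : exists v, c i *: s i = d * v.
    have [_ [a _ <-] [x _ <-]] := Ss i.
    by exists (c i *: (a *: x)); rewrite -!(scalerAl, scalerAr).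
  by exists (\sum_i v i); rewrite sum1 mulr_sumr; apply: eq_bigr.
have [u' u'd] : exists u, 1 = u * d.
  have /choice[v vP] i : exists v, b i *: t i = v * d.
    have [x _ [_ [a _ <-] <-]] := St i.
    by exists (b i *: (a *: x)); rewrite -!(scalerAl, scalerAr).
  by exists (\sum_i v i); rewrite sum2 mulr_suml; apply: eq_bigr.
have uu' : u = u' by rewrite -[u]mul1r u'd -mulrA -du mulr1.
rewrite -uu' in u'd; exists u; split=> // g.
rewrite -[Gact g u]mul1r u'd -mulrA -[in d * _](dfix g).
by rewrite -rmorphM -du rmorph1 mulr1.
Qed.

(** [X A = A] forces [X Y] outside the augmentation [B] for some irreducible
    [Y], so [X Y] contains a nonzero invariant [d].  The ring of invariants may
    be a division ring larger than [k], so [d] need not be a scalar; replacing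
    [Y] by the isomorphic submodule [Y d^-1] turns [d] into [1]. *)
Lemma ex_right_cofactor : completely_reducible A -> finite_length A ->
  unital_ideals -> forall X, QG X -> exists2 Y, QG Y & mulS X Y 1.
Proof.
move=> cr fl ui X QX; have [SX Xnz _] := QX.
have [XA1 _] := ui X SX Xnz.
have [B [SB nB1 Bfix]] := ex_augmentation cr fl; have B0 : B 0 by case: SB.
have [Y QY XYB] : exists2 Y, QG Y & ~ mulS X Y `<=` B.
  apply: contrapT => no; apply: nB1.
  suff XAB : forall x y, X x -> setT y -> B (x * y).
    exact: (mulS_subP SB XAB XA1).
  move=> x y Xx _; move: y; apply: completely_reducible_sum => //
      [|y z Bxy Bxz|Y QY y Yy].
  - by rewrite mulr0.
  - by rewrite mulrDr; apply: SG_add.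
  - apply: contrapT => nB; apply: no; exists Y => // XYB.
    by apply: nB; apply: XYB; exact: mulS_mem.
have [SY _ _] := QY; have [d [XYd dnz dfix]] := Bfix _ (SG_mulS SX SY) XYB.
have [d' [dd' d'd d'fix]] := fixed_inverse ui dnz dfix.
have QYd : QG ((fun y => y * d') @` Y).
  apply: (@QG_image (fun y => y * d') (fun y => y * d)) QY.
  - by move=> c x y; rewrite mulrDl scalerAl.
  - by move=> c x y; rewrite mulrDl scalerAl.
  - by move=> g x; rewrite /= rmorphM /= d'fix.
  - by move=> g x; rewrite /= rmorphM /= dfix.
  - by move=> x; rewrite -mulrA d'd mulr1.
  - by move=> x; rewrite -mulrA dd' mulr1.
exists ((fun y => y * d') @` Y) => //.
have [SYd _ _] := QYd; have SXYd := SG_mulS SX SYd.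
have [n [c [s [Ss dsum]]]] := XYd.
rewrite -dd' dsum mulr_suml; apply: SG_sum => // i.
have [x Xx [y Yy <-]] := Ss i.
rewrite -scalerAl -mulrA; apply: SG_scale => //.
by apply: mulS_mem => //; exists y.
Qed.

Lemma ex_left_cofactor : completely_reducible A -> finite_length A ->
  unital_ideals -> forall X, QG X -> exists2 Z, QG Z & mulS Z X 1.
Proof.
move=> cr fl ui X QX; have [SX Xnz _] := QX.
have [_ AX1] := ui X SX Xnz.
have [B [SB nB1 Bfix]] := ex_augmentation cr fl; have B0 : B 0 by case: SB.
have [Z QZ ZXB] : exists2 Z, QG Z & ~ mulS Z X `<=` B.
  apply: contrapT => no; apply: nB1.
  suff AXB : forall z x, setT z -> X x -> B (z * x).
    exact: (mulS_subP SB AXB AX1).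
  move=> z x _ Xx; move: z; apply: completely_reducible_sum => //
      [|y z Byx Bzx|Z QZ z Zz].
  - by rewrite mul0r.
  - by rewrite mulrDl; apply: SG_add.
  - apply: contrapT => nB; apply: no; exists Z => // ZXB.
    by apply: nB; apply: ZXB; exact: mulS_mem.
have [SZ _ _] := QZ; have [d [ZXd dnz dfix]] := Bfix _ (SG_mulS SZ SX) ZXB.
have [d' [dd' d'd d'fix]] := fixed_inverse ui dnz dfix.
have QdZ : QG ((fun z => d' * z) @` Z).
  apply: (@QG_image (fun z => d' * z) (fun z => d * z)) QZ.
  - by move=> c x y; rewrite mulrDr scalerAr.
  - by move=> c x y; rewrite mulrDr scalerAr.
  - by move=> g x; rewrite /= rmorphM /= d'fix.
  - by move=> g x; rewrite /= rmorphM /= dfix.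
  - by move=> x; rewrite mulrA dd' mul1r.
  - by move=> x; rewrite mulrA d'd mul1r.
exists ((fun z => d' * z) @` Z) => //.
have [SdZ _ _] := QdZ; have SdZX := SG_mulS SdZ SX.
have [n [c [s [Ss dsum]]]] := ZXd.
rewrite -d'd dsum mulr_sumr; apply: SG_sum => // i.
have [z Zz [x Xx <-]] := Ss i.
rewrite -scalerAr mulrA; apply: SG_scale => //.
by apply: mulS_mem => //; exists z.
Qed.

Lemma weakly_reproducible_of_unital_ideals :
  completely_reducible A -> finite_length A -> unital_ideals ->
  weakly_reproducible A.
Proof.
move=> cr fl ui; split=> [|X QX]; first exact: entire_of_unital_ideals.
have [Y QY XY1] := ex_right_cofactor cr fl ui QX.
have [Z QZ ZX1] := ex_left_cofactor cr fl ui QX.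
have [[SX _ _] [SY _ _] [SZ _ _]] := And3 QX QY QZ.
by exists Y, Z; split=> //; apply: scalars_sub => //; apply: SG_mulS.
Qed.

(** * The two cases *)

Lemma field_unital_ideals (L : fieldType) (phi : {rmorphism A -> L}) :
  bijective phi -> unital_ideals.
Proof.
move=> [psi phiK psiK] E SE Enz; have [x Ex xnz] := SG_neq0 SE Enz.
have phix : phi x != 0.
  by apply: contraNneq xnz => phix0; rewrite -[x]phiK phix0 -(rmorph0 phi) phiK.
split.
- suff -> : 1 = x * psi (phi x)^-1 by apply: mulS_mem.
  by apply: (can_inj phiK); rewrite rmorphM rmorph1 psiK divff.
- suff -> : 1 = psi (phi x)^-1 * x by apply: mulS_mem.
  by apply: (can_inj phiK); rewrite rmorphM rmorph1 psiK mulVf.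
Qed.

Lemma vspace_of_SG (W : vectType k) (phi : {linear A -> W}) E : SG E ->
  exists U : {vspace W}, forall w, w \in U <-> exists2 a, E a & phi a = w.
Proof.
move=> [E0 EL _]; apply: vspace_of_set.
  by exists 0; rewrite ?linear0.
move=> c _ _ [a Ea <-] [b Eb <-]; exists (c *: a + b); first exact: EL.
by rewrite linearP.
Qed.

(** A strict chain of submodules has strictly increasing dimensions. *)
Lemma finite_length_linear (W : vectType k) (phi : {linear A -> W}) :
  injective phi -> finite_length A.
Proof.
move=> phiI; exists (\dim {:W}) => m C SC ltC.
have /choice[U UP] i : exists U : {vspace W}, (i <= m)%N ->
    forall w, w \in U <-> exists2 a, C i a & phi a = w.
  have [im|_] := boolP (i <= m)%N; last by exists 0%VS.
  by have [U UP] := vspace_of_SG phi (SC i im); exists U.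
suff le_dim i : (i <= m)%N -> (i <= \dim (U i))%N.
  by apply: leq_trans (le_dim m (leqnn m)) _; apply: dimvS; exact: subvf.
elim: i => // i IH im; apply: leq_ltn_trans (IH (ltnW im)) _.
have [CC nCC] := ltC i im.
have UU : (U i <= U i.+1)%VS.
  apply/subvP => _ /(UP i (ltnW im))[a Ca <-]; apply/(UP _ im).
  by exists a => //; exact: CC.
rewrite (ltn_leqif (dimv_leqif_sup UU)); apply/negP => /subvP UU'.
apply: nCC => a Ca.
have /UU'/(UP _ (ltnW im))[b Cb /phiI <- //] : phi a \in U i.+1.
by apply/(UP _ im); exists a.
Qed.

(** [E V] and the common kernel of [E] are both stable under the projective
    representation, because [h (a v) = (g a) (h v)] whenever [h] represents [g].
    By irreducibility [E V = V] and the common kernel is [0].  Written out on a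
    basis [e] of [E], these facts say that the [e i] are jointly surjective and
    jointly injective, so the identity is a sum of terms [e i \o f i] as well as
    a sum of terms [f i \o e i]. *)
Lemma End_unital_ideals (V : vectType k) (phi : {linear A -> 'End(V)}) :
  bijective phi -> phi 1 = \1%VF ->
  (forall a b, phi (a * b) = (phi a \o phi b)%VF) ->
  proj_irreducible phi -> unital_ideals.
Proof.
move=> [psi phiK psiK] phi1 phiM irr E SE Enz.
have conj g h a v : PGL_class phi g h -> phi (Gact g a) (h v) = h (phi a v).
  by case=> h0 ->; rewrite !comp_lfunE lker0_lfunK.
have [U UP] := vspace_of_SG phi SE.
pose n := \dim U; pose e (i : 'I_n) := (vbasis U)`_i.
have eU i : e i \in U.
  by apply/vbasis_mem/mem_nth; rewrite size_tuple.
have /choice[s sP] i : exists a, E a /\ phi a = e i.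
  by have /UP[a Ea <-] := eU i; exists a.
have [_ _ EG] := SE.
have phiE a : E a -> exists c : 'I_n -> k, phi a = \sum_i c i *: e i.
  move=> Ea; exists (fun i => coord (vbasis U) i (phi a)).
  by apply: coord_vbasis; apply/UP; exists a.
have phi_nz : ~ forall a v, E a -> phi a v = 0.
  have [x Ex /eqP xnz] := SG_neq0 SE Enz => phi0; apply: xnz.
  apply: (can_inj phiK); rewrite linear0; apply/lfunP => v.
  by rewrite phi0 // lfunE.
have sum1 f : (\sum_i (e i \o f i))%VF = \1%VF -> mulS E setT 1.
  move=> ef1; suff -> : 1 = \sum_i s i * psi (f i).
    apply: SG_sum => [|i]; last by apply: mulS_mem => //; case: (sP i).
    by apply: SG_mulS => //; split.
  apply: (can_inj phiK); rewrite phi1 linear_sum -ef1; apply: eq_bigr => i _.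
  by rewrite phiM psiK; case: (sP i) => _ ->.
have sum2 f : (\sum_i (f i \o e i))%VF = \1%VF -> mulS setT E 1.
  move=> ef1; suff -> : 1 = \sum_i psi (f i) * s i.
    apply: SG_sum => [|i]; last by apply: mulS_mem => //; case: (sP i).
    by apply: SG_mulS => //; split.
  apply: (can_inj phiK); rewrite phi1 linear_sum -ef1; apply: eq_bigr => i _.
  by rewrite phiM psiK; case: (sP i) => _ ->.
split.
- have imE a : E a -> forall v, phi a v \in (\sum_i limg (e i))%VS.
    move=> /phiE[c ->] v; rewrite sum_lfunE; apply: memv_suml => i _.
    rewrite lfunE /=; apply: memvZ.
    apply: (subvP (sumv_sup i _ (subvv _))) => //.
    exact: memv_img (memvf _).
  have [|im0|imf] := irr (\sum_i limg (e i))%VS.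
  + move=> g h gh; rewrite limg_sum; apply/subv_sumP => i _; apply/subvP => w.
    move=> /memv_imgP[u /memv_imgP[v _ ->] ->]; have [Es <-] := sP i.
    by rewrite -(conj g) //; apply: imE; exact: EG.
  + by case: phi_nz => a v /imE-/(_ v); rewrite im0 memv0 => /eqP.
  + by have [f] := right_inverse_sum imf; exact: sum1.
- have kerE a v : E a -> v \in (\bigcap_i lker (e i))%VS -> phi a v = 0.
    move=> /phiE[c ->] /memv_bigcap_lker kv; rewrite sum_lfunE big1 // => i _.
    by rewrite lfunE /=; rewrite kv scaler0.
  have [|ker0|kerf] := irr (\bigcap_i lker (e i))%VS.
  + move=> g h gh; apply/subvP => w /memv_imgP[v kv ->].
    apply/memv_bigcap_lker => i; have [Es <-] := sP i.
    rewrite -[s i]Gact1 -(mulgV g) GactM (conj g) // kerE ?linear0 //.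
    exact: EG.
  + by have [f] := left_inverse_sum ker0; exact: sum2.
  + by case: phi_nz => a v Ea; rewrite kerE // kerf memvf.
Qed.

End Submodules.

Theorem corollary6p3 (k : fieldType) (G : groupType) (A : Galgebra k G) :
  completely_reducible A ->
  is_finite_Galois_extension A \/ is_End_of_irreducible_projective_rep A ->
  weakly_reproducible A /\ finite_length A.
Proof.
move=> cr Acase; have [fl ui] : finite_length A /\ unital_ideals A.
  case: Acase => [[L [phi [_ [_ phi_bij _ _ _]]]]|
                  [V [phi [_ phi_bij phi1 phiM irr]]]].
  - split; first exact: (finite_length_linear (bij_inj phi_bij)).
    exact: field_unital_ideals phi_bij.
  - split; first exact: (finite_length_linear (bij_inj phi_bij)).
    exact: End_unital_ideals irr.
by split=> //; exact: weakly_reproducible_of_unital_ideals.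
Qed.
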